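(* Let $k>0$, $m>0$ and $n>1$ be integers and let $G=\overline{k}\,|m|\,\overline{n}$ (the component consisting, from left to right, of $k$ bulbs, then $m$ sockets, then $n$ bulbs). Then $$\mathcal{G}(G)=\begin{cases} k+n & \text{if } m \text{ is odd},\\ k+n+(-1)^n & \text{if } m \text{ is even}.\end{cases}$$
   Context: The ruleset CHRISTMAS LIGHTS' FIXTURE. A component is a finite (possibly empty) word, read from left to right, in two kinds of pieces: bulbs and sockets. The ruleset is impartial; the moves available in a component are: (1) choose a bulb: that bulb and every piece to its right are deleted (a quiet move); (2) choose a socket that does not have bulbs as both its left and right neighbours (either neighbour is a socket or does not exist): only that socket is deleted and the two ends are joined (a quiet move); (3) choose a socket whose left and right neighbours both exist and are bulbs: only that socket is deleted, the two ends are joined, and the same player must move again, in any component of the current disjunctive sum (a carry-on move). A player who has to move and has no move loses (normal play). A disjunctive sum of components (and nim heaps) is played by moving in exactly one summand at each move, with players alternating except for carry-on moves. A $\mathcal P$-position is one that the previous player (the one not about to move) wins; an $\mathcal N$-position is one that the next player wins. Grundy-value. $\mathcal{G}(G)\in\{0,1,2,\dots\}\cup\{\infty\}$ is defined recursively. Let $S_G$ be the set of all finite Grundy-values of components reachable from $G$ by one quiet move. Let $P_G$ be the set of nonnegative integers $j$ such that some carry-on move leads from $G$ to a component $G'$ with $\mathcal{G}(G')\neq j$ (so $\mathcal G(G')=\infty$ protects every $j$). Then $\mathcal{G}(G)=\operatorname{mex}(S_G\cup P_G)$, the least nonnegative integer not in $S_G\cup P_G$, and $\mathcal{G}(G)=\infty$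 if $S_G\cup P_G$ contains all nonnegative integers. Equivalently, $\mathcal{G}(G)=n<\infty$ iff the sum of $G$ and a nim heap $*n$ of size $n$ is a $\mathcal P$-position, and $\mathcal{G}(G)=\infty$ iff there is no such $n$. Notation: $\overline{n}$ is a string of $n$ consecutive bulbs, $|m|$ is a string of $m$ consecutive sockets, and juxtaposition is concatenation from left to right. *)

(* Defs.v *)
From mathcomp Require Import all_boot.
From mathcomp Require Import boolp classical_sets.

Set Implicit Arguments.
Unset Strict Implicit.
Unset Printing Implicit Defensive.

Local Open Scope nat_scope.
Local Open Scope classical_set_scope.

Inductive piece := Bulb | Socket.

Definition is_bulb (p : piece) : bool := if p is Bulb then true else false.

Definition component := seq piece.

(* A missing neighbour behaves like a socket, hence the default values. *)
Definition between_bulbs (l r : component) : bool :=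
  is_bulb (last Socket l) && is_bulb (head Socket r).

Inductive quiet_move : component -> component -> Prop :=
| QuietBulb l r : quiet_move (l ++ Bulb :: r) l
| QuietSocket l r :
    ~~ between_bulbs l r -> quiet_move (l ++ Socket :: r) (l ++ r).

Inductive carry_on_move : component -> component -> Prop :=
| CarryOn l r :
    between_bulbs l r -> carry_on_move (l ++ Socket :: r) (l ++ r).

Lemma quiet_move_size G G' : quiet_move G G' -> size G' < size G.
Proof.
by case=> [l r|l r _]; rewrite !size_cat /= addnS ltnS // leq_addr.
Qed.

Lemma carry_on_move_size G G' : carry_on_move G G' -> size G' < size G.
Proof. by case=> l r _; rewrite !size_cat /= addnS. Qed.

(* Grundy-values in {0, 1, 2, ...} + {oo}: None stands for oo. *)
Definition gvalue := option nat.

Definition mex (A : set nat) : gvalue :=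
  match pselect (exists n, `[< ~ A n >]) with
  | left exA => Some (ex_minn exA)
  | right _ => None
  end.

Lemma mex_SomeP (A : set nat) n :
  mex A = Some n <-> ~ A n /\ (forall i, i < n -> A i).
Proof.
rewrite /mex; case: pselect => [exA|nexA]; last first.
  by split=> // -[nAn _]; case: nexA; exists n; apply/asboolP.
case: ex_minnP => m /asboolP nAm m_min; split=> [[<-]|[nAn An]].
  split=> // i lt_im; apply: contrapT => nAi.
  by have := m_min i (asboolT nAi); rewrite leqNgt lt_im.
congr Some; apply/eqP; rewrite eqn_leq m_min ?asboolT //= leqNgt.
by apply/negP => /An.
Qed.

Lemma mex_NoneP (A : set nat) : mex A = None <-> (forall i, A i).
Proof.
rewrite /mex; case: pselect => [exA|nexA]; split=> //.
  by move=> allA; exfalso; case: exA => i /asboolP; apply.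
by move=> _ i; apply: contrapT => nAi; apply: nexA; exists i; apply/asboolP.
Qed.

(* The two sets are S_G and P_G; a carry-on move to a component of value oo
   puts every j in P_G, since None <> Some j. *)
Definition grundy_step (G : component)
    (g : forall G' : component, size G' < size G -> gvalue) : gvalue :=
  mex ([set j | exists G' (mv : quiet_move G G'),
                  g G' (quiet_move_size mv) = Some j] `|`
       [set j | exists G' (mv : carry_on_move G G'),
                  g G' (carry_on_move_size mv) <> Some j]).

Definition size_lt (G' G : component) : Prop := size G' < size G.

Lemma size_lt_wf : well_founded size_lt.
Proof.
suff wf n G : size G < n -> Acc size_lt G by move=> G; apply: (wf _ _ (leqnn _)).
elim: n G => [|n IHn] G; first by rewrite ltn0.
rewrite ltnS => leGn; constructor=> G' ltG'G.
by apply: IHn; apply: leq_trans leGn.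
Qed.

Definition grundy : component -> gvalue :=
  Fix size_lt_wf (fun=> gvalue) grundy_step.

Lemma grundyE (G : component) :
  grundy G = mex ([set j | exists2 G', quiet_move G G' & grundy G' = Some j] `|`
                  [set j | exists2 G', carry_on_move G G' & grundy G' <> Some j]).
Proof.
have -> : grundy G = @grundy_step G (fun G' _ => grundy G').
  apply: (Fix_eq size_lt_wf (fun=> gvalue) grundy_step) => H f g fg.
  suff -> : f = g by [].
  apply: functional_extensionality_dep => G'.
  by apply: functional_extensionality_dep => ltG'H; apply: fg.
rewrite /grundy_step; congr mex; apply/seteqP.
split=> j [] [G'].
- by case=> mv e; left; exists G'.
- by case=> mv e; right; exists G'.
- by move=> mv e; left; exists G', mv.
- by move=> mv e; right; exists G', mv.
Qed.

Definition bulbs (n : nat) : component := nseq n Bulb.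
Definition sockets (m : nat) : component := nseq m Socket.

(* Main.v *)
(** Deleting bulbs or a socket from [k |m| n] yields [j] with [j < k],
    [k |m| j] with [j < n], or [k |m-1| n].  For fixed [m] the values of
    [k |m| n] are [k + pairing m n], where the involution [pairing m] either
    fixes or exchanges the two elements of each block [{2i, 2i+1}], doing the
    opposite on each block when [m] changes parity.  Hence [k |m-1| n] takes
    the value of the partner of [pairing m n], and the mex can be read off.
    The only irregularity is [k |1| 1], of value oo: its carry-on move excludes
    all values but [k + 1], which its option [k |1|] has. *)
Require Import Defs.
From mathcomp Require Import all_boot all_order all_algebra.
From mathcomp Require Import zify.

Local Notation fixture k m n := (bulbs k ++ sockets m ++ bulbs n).

(** Membership in the union of [S_G] and [P_G], whose mex is the Grundy-value. *)
Definition excluded (G : component) (j : nat) : Prop :=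
  (exists2 G', quiet_move G G' & grundy G' = Some j) \/
  (exists2 G', carry_on_move G G' & grundy G' <> Some j).

Lemma grundy_SomeP (G : component) (n : nat) :
  grundy G = Some n <-> ~ excluded G n /\ forall i, i < n -> excluded G i.
Proof. by rewrite grundyE; apply: mex_SomeP. Qed.

Lemma grundy_NoneP (G : component) : grundy G = None <-> forall i, excluded G i.
Proof. by rewrite grundyE; apply: mex_NoneP. Qed.

Lemma cat_nseq_inv {T : Type} {x : T} {a : nat} {s l r : seq T} {p : T} :
  nseq a x ++ s = l ++ p :: r ->
  (exists j, [/\ j < a, p = x, l = nseq j x & r = nseq (a - j.+1) x ++ s]) \/
  (exists2 l', l = nseq a x ++ l' & s = l' ++ p :: r).
Proof.
elim: a l => [|a IHa] [|y l] /= e; first by right; exists [::].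
- by right; exists (y :: l).
- by case: e => <- <-; left; exists 0; rewrite subn1.
case: e => <- /IHa[[j [ltja -> -> ->]]|[l' -> ->]].
  by left; exists j.+1.
by right; exists l'.
Qed.

Lemma fixture_inv {k m n : nat} {l r : component} {p : piece} :
  fixture k m n = l ++ p :: r ->
  [\/ exists j, [/\ j < k, p = Bulb & l = bulbs j],
      exists i, [/\ i < m, p = Socket, l = bulbs k ++ sockets i
                  & r = sockets (m - i.+1) ++ bulbs n]
    | exists j, [/\ j < n, p = Bulb & l = fixture k m j]].
Proof.
case/cat_nseq_inv => [[j [ltjk -> -> _]]|[l' -> /cat_nseq_inv[]]].
- by apply: Or31; exists j.
- by case=> i [ltim -> -> ->]; apply: Or32; exists i.
(* An empty tail is appended so that the last run, too, has the shape split by [cat_nseq_inv]. *)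
case=> l'' ->; rewrite -[bulbs n]cats0 => /cat_nseq_inv[].
  by case=> j [ltjn -> -> _]; apply: Or33; exists j.
by case=> -[].
Qed.

(** Socket [i] can have a bulb on its left only if [i = 0], and on its right only if [i = m.-1];
    both happen only for a lone socket. *)
Lemma between_bulbs_fixture (k : nat) {m : nat} (n : nat) {i : nat} : i < m ->
  between_bulbs (bulbs k ++ sockets i) (sockets (m - i.+1) ++ bulbs n) =
  [&& 0 < k, m == 1 & 0 < n].
Proof.
move=> ltim; rewrite /between_bulbs last_cat.
have lastN (j : nat) (x q : piece) : last x (nseq j q) = if j is 0 then x else q.
  by elim: j x => //= j IHj x; rewrite IHj; case: j {IHj}.
rewrite !lastN; case: i ltim => [|i] ltim /=; last by rewrite andbC; lia.
by case: m ltim => [|[|m]] //= _; case: k; case: n.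
Qed.

(** The result does not depend on [i], so all socket moves count as a single option. *)
Lemma remove_socket (k m n i : nat) : i < m ->
  (bulbs k ++ sockets i) ++ sockets (m - i.+1) ++ bulbs n = fixture k m.-1 n.
Proof.
by move=> ltim; rewrite -catA (catA (sockets i)) /sockets -nseqD; do 3!f_equal; lia.
Qed.

Lemma quiet_move_fixtureP (k m n : nat) (G' : component) :
  quiet_move (fixture k m n) G' <->
  [\/ exists2 j, j < k & G' = bulbs j,
      exists2 j, j < n & G' = fixture k m j
    | [/\ 0 < m, ~~ [&& 0 < k, m == 1 & 0 < n] & G' = fixture k m.-1 n]].
Proof.
split.
  move eG: (fixture k m n) => G mv; case: mv eG => [l r|l r nb] /fixture_inv[].
  - by case=> j [ltjk _ ->]; apply: Or31; exists j.
  - by case=> i [].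
  - by case=> j [ltjn _ ->]; apply: Or32; exists j.
  - by case=> i [].
  - case=> i [ltim _ el er]; apply: Or33.
    rewrite el er remove_socket //.
    by rewrite el er between_bulbs_fixture // in nb; split=> //; lia.
  - by case=> i [].
case=> [[j ltjk ->]|[j ltjn ->]|[m_gt0 nb ->]].
- rewrite {1}/bulbs -(subnKC ltjk) addSnnS nseqD -catA; exact: QuietBulb.
- rewrite [bulbs n]/bulbs -(subnKC ltjn) addSnnS nseqD !catA -(catA _ _ (bulbs j)).
  rewrite -[_ ++ nseq (_).+1 _]/(_ ++ Bulb :: nseq (n - j.+1) Bulb).
  exact: QuietBulb.
(* The first socket, [i = 0], serves as the deleted one. *)
- rewrite -(between_bulbs_fixture k n m_gt0) in nb.
  have := QuietSocket nb; rewrite remove_socket // -catA.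
  by case: m m_gt0 {nb} => //= m _; rewrite subn1.
Qed.

Lemma carry_on_move_fixtureP (k m n : nat) (G' : component) :
  carry_on_move (fixture k m n) G' <->
  [&& 0 < k, m == 1 & 0 < n] /\ G' = fixture k m.-1 n.
Proof.
split.
  move eG: (fixture k m n) => G mv; case: mv eG => l r b /fixture_inv[].
  - by case=> i [].
  - case=> i [ltim _ el er].
    by rewrite el er remove_socket // -(between_bulbs_fixture k n ltim) -el -er.
  - by case=> i [].
case=> b ->; have m_gt0 : 0 < m by lia.
rewrite -(between_bulbs_fixture k n m_gt0) in b.
have := CarryOn b; rewrite remove_socket // -catA.
by case: m m_gt0 {b} => //= m _; rewrite subn1.
Qed.

Lemma excluded_fixtureP (k m n v : nat) :
  excluded (fixture k m n) v <->
  [\/ exists2 j, j < k & grundy (bulbs j) = Some v,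
      exists2 j, j < n & grundy (fixture k m j) = Some v
    | 0 < m /\ if [&& 0 < k, m == 1 & 0 < n]
               then grundy (fixture k m.-1 n) <> Some v
               else grundy (fixture k m.-1 n) = Some v].
Proof.
split.
  case=> [[G' /quiet_move_fixtureP[]]|[G' /carry_on_move_fixtureP[]]].
  - by case=> j ltjk -> e; apply: Or31; exists j.
  - by case=> j ltjn -> e; apply: Or32; exists j.
  - by case=> m_gt0 /negPf-> -> e; apply: Or33.
  - by move=> b -> e; apply: Or33; rewrite b; split=> //; lia.
case=> [[j ltjk e]|[j ltjn e]|[m_gt0]].
- by left; exists (bulbs j) => //; apply/quiet_move_fixtureP/Or31; exists j.
- by left; exists (fixture k m j) => //; apply/quiet_move_fixtureP/Or32; exists j.
case: ifP => [b|/negbT b] e; [right|left]; exists (fixture k m.-1 n) => //.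
  exact/carry_on_move_fixtureP.
by apply/quiet_move_fixtureP/Or33.
Qed.

Lemma grundy_bulbs (n : nat) : grundy (bulbs n) = Some n.
Proof.
elim/ltn_ind: n => n IHn; apply/grundy_SomeP.
(* A row of bulbs is read as [fixture n 0 0], so that [excluded_fixtureP] applies. *)
rewrite -[bulbs n]cats0 -[[::]]/(sockets 0 ++ bulbs 0).
split=> [|i ltin].
  by case/excluded_fixtureP => [[j ltjn]|[]|[]] //; rewrite IHn // => -[]; lia.
by apply/excluded_fixtureP/Or31; exists i; rewrite ?IHn.
Qed.

(** Flips the lowest binary digit: the nim-sum of [n] and 1. *)
Definition partner (n : nat) : nat := if odd n then n.-1 else n.+1.

(** The block {0, 1} is out of phase with the others because for [m = 1] the socket move is quiet
    when [n = 0] but carry-on when [n >= 2]. *)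
Definition pairing (m n : nat) : nat :=
  if odd m == (n < 2) then partner n else n.

Lemma pairingK (m : nat) : involutive (pairing m).
Proof. by move=> n; rewrite /pairing /partner; do !case: ifP; lia. Qed.

Lemma pairing_succ (m n : nat) : pairing m n = partner (pairing m.+1 n).
Proof. by rewrite /pairing /partner /=; do !case: ifP; lia. Qed.

Lemma partner_neq (n : nat) : partner n != n.
Proof. by rewrite /partner; case: ifP; lia. Qed.

(* For (m, n) = (2, 1) the partner's value is not on offer: k |1| 1 has value oo. *)
Lemma lt_pairing {m n i : nat} : i < pairing m n ->
  pairing m i < n \/ i = partner (pairing m n) /\ (m, n) <> (2, 1).
Proof.
have [[-> ->]|ne] := (m, n) =P (2, 1).
  by case: i => //; left.
rewrite /pairing /partner => lti.
(* If [i] lies in an earlier block than [n], so does [pairing m i]; otherwise [i] and [pairing m n]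
   are the two elements of one block. *)
suff: pairing m i < n \/ i = partner (pairing m n) by case; auto.
by rewrite /pairing /partner; move: lti; do !case: ifP; lia.
Qed.

Lemma grundy_fixture (k m n : nat) : 0 < k -> 0 < m ->
  grundy (fixture k m n) =
  if (m == 1) && (n == 1) then None else Some (k + pairing m n).
Proof.
move=> k_gt0; elim: m n => // m IHm n _.
elim/ltn_ind: n => n IHn.
have lt_k i : i < k -> excluded (fixture k m.+1 n) i.
  by move=> ltik; apply/excluded_fixtureP/Or31; exists i; rewrite ?grundy_bulbs.
(* This separates the lone socket between bulbs, the only case with a carry-on move. *)
have [/andP[/eqP[m0] n_gt0]|regular] := boolP ((m.+1 == 1) && (0 < n)).
  subst m; have grundy_joined : grundy (fixture k 0 n) = Some (k + n).
    by rewrite [_ ++ _]catA cats0 /bulbs -nseqD grundy_bulbs.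
  have carry i : i <> k + n -> excluded (fixture k 1 n) i.
    move=> ne; apply/excluded_fixtureP/Or33; split=> //.
    by rewrite k_gt0 n_gt0 grundy_joined => -[/esym].
  have [n1|n_neq1] := eqVneq n 1.
    subst n; apply/grundy_NoneP=> i; have [->|ne] := eqVneq i (k + 1); last exact/carry/eqP.
    by apply/excluded_fixtureP/Or32; exists 0; rewrite ?IHn.
  have -> : pairing 1 n = n by rewrite /pairing; case: ifP => //; lia.
  apply/grundy_SomeP; split=> [|i lti]; last by apply: carry; lia.
  case/excluded_fixtureP => [[j ltjk]|[j ltjn]|[_]].
  - by rewrite grundy_bulbs => -[]; lia.
  - rewrite IHn //; case: ifP => // _ [/addnI].
    by rewrite /pairing /partner; do !case: ifP; lia.
  - by rewrite k_gt0 n_gt0 grundy_joined.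
have grundy_fewer : (m, n) <> (1, 1) ->
    grundy (fixture k m n) = Some (k + partner (pairing m.+1 n)).
  rewrite -pairing_succ => ne; have [m0|m_gt0] := posnP m.
    (* By [regular], a lone socket now has no bulbs on its right. *)
    by subst m; have -> : n = 0; [lia | rewrite !cats0 grundy_bulbs addn0].
  by rewrite IHm //; case: ifP => // /andP[/eqP m1 /eqP n1]; case: ne; congr pair.
have -> : (m.+1 == 1) && (n == 1) = false by lia.
have not_carry : [&& 0 < k, m.+1 == 1 & 0 < n] = false by rewrite k_gt0; lia.
have regular_lt j : j < n -> (m.+1 == 1) && (j == 1) = false by lia.
apply/grundy_SomeP; split=> [|i lti].
  case/excluded_fixtureP => [[j ltjk]|[j ltjn]|[_]].
  - by rewrite grundy_bulbs => -[]; lia.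
  - rewrite IHn // regular_lt // => -[/addnI/(can_inj (pairingK _))].
    by move=> ejn; rewrite ejn ltnn in ltjn.
  - rewrite not_carry; have [[em en]|ne] := (m, n) =P (1, 1).
    (* From [k |2| 1] the quiet socket move leads to [k |1| 1], whose value oo excludes nothing. *)
    + by subst m n; rewrite IHm.
    + rewrite grundy_fewer // => -[/addnI e].
      by have := partner_neq (pairing m.+1 n); rewrite e eqxx.
have [/lt_k//|leki] := ltnP i k.
rewrite -(subnKC leki) in lti *; move: lti; rewrite ltn_add2l.
case/lt_pairing => [ltn|[-> ne]]; apply/excluded_fixtureP.
  (* As [pairing m.+1] is an involution, keeping this many right bulbs gives the value
     [k + (i - k)]. *)
  by apply: Or32; exists (pairing m.+1 (i - k)); rewrite ?IHn ?regular_lt ?pairingK.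
apply: Or33; rewrite not_carry grundy_fewer //.
by case=> em en; apply: ne; rewrite em en.
Qed.

Local Open Scope ring_scope.

Theorem theorem5 (k m n : nat) (hk : (0 < k)%N) (hm : (0 < m)%N)
    (hn : (1 < n)%N) :
  omap Posz (grundy (bulbs k ++ sockets m ++ bulbs n)) =
  Some (if odd m then k%:Z + n%:Z else k%:Z + n%:Z + (-1) ^+ n).
Proof.
rewrite grundy_fixture //; have -> : (n == 1)%N = false by lia.
(* For [n >= 2], [pairing m n] is [n] when [m] is odd and [partner n], that is [n + (-1)^n], when
   [m] is even. *)
rewrite andbF /=; congr Some; rewrite -GRing.signr_odd /pairing /partner.
by rewrite ltnNge hn; case: (odd m) => /=; case: (odd n) => /=; lia.
Qed.
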